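(* For each integer $g \ge 2$ there exists a $\mathrm{GDD}(4,5,10g+7g)$ of type $g^{10}(7g)^1$.
   Context: A group divisible design $\mathrm{GDD}(t,k,m)$ of type $g_1^{n_1} g_2^{n_2}\cdots g_r^{n_r}$, where $t \ge 2$ and $m=\sum_{i=1}^r n_i g_i$, is a triple $(X,G,B)$ such that $X$ is a set of $m$ points; $G$ is a partition of $X$ into $n=\sum_{i=1}^r n_i$ groups, of which $n_i$ have exactly $g_i$ points, $1\le i\le r$; $B$ is a set of $k$-subsets of $X$ (blocks); each block contains at most one point from each group; and each $t$-subset of $X$ which contains at most one point from each group is contained in exactly one block of $B$. *)

(* Defs.v *)
From mathcomp Require Import all_boot.
Set Implicit Arguments.
Unset Strict Implicit.
Unset Printing Implicit Defensive.

Definition transverse (X : finType) (G : {set {set X}}) (S : {set X}) : Prop :=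
  forall A, A \in G -> #|S :&: A| <= 1.

(* A type g_1^{n_1} ... g_r^{n_r} is encoded as the list
   [:: (g_1, n_1); ...; (g_r, n_r)]; [tally_seq] expands it into the list in
   which each g_i is repeated n_i times, so [gdd_type] says that the multiset
   of group sizes is the prescribed one. *)
Record is_gdd (t k m : nat) (tau : seq (nat * nat)) (X : finType)
    (G B : {set {set X}}) : Prop := IsGDD {
  gdd_strength : 2 <= t;
  gdd_order : m = \sum_(p <- tau) p.2 * p.1;
  gdd_points : #|X| = m;
  gdd_partition : partition G [set: X];
  gdd_type : perm_eq [seq #|A| | A : {set X} in G] (tally_seq tau);
  gdd_block_size : forall b, b \in B -> #|b| = k;
  gdd_block_transverse : forall b, b \in B -> transverse G b;
  gdd_cover : forall T : {set X}, #|T| = t -> transverse G T ->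
    exists! b : {set X}, b \in B /\ T \subset b
}.

(* Main.v *)
Require Import Defs.
From mathcomp Require Import all_boot.
Set Implicit Arguments.
Unset Strict Implicit.
Unset Printing Implicit Defensive.

(** A Steiner quadruple system SQS(10) is a set of 4-subsets of a 10-set V such
    that each 3-subset lies in exactly one of them.  Suppose that S_0, S_1, ...
    is a list of 7g such systems, repetitions allowed, in which every 4-subset
    of V occurs exactly g times; since every 3-subset lies in 7 quadruples, the
    length 7g is forced.  Take as points the pairs (v, i) with v in V and i in
    Z_g, which make up the ten groups of size g, together with one point for
    each index j, which make up the group of size 7g.

    For each 4-subset Q, number the g indices j with Q in S_j from 0 to g - 1;
    call this number the rank of j for Q.  The blocks are the sets consisting
    of an index j and of points (v, x_v), one for each v in a quadruple Q of
    S_j, such that the sum of the x_v is congruent to the rank of j for Q.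

    A transverse 4-set of points lies in exactly one block:
    - if it consists of an index j and three points over a triple T of V, then
      Q must be the quadruple of S_j through T, and the congruence determines
      the height of the point over the remaining element of Q
      ([block_extension_with_index]);
    - if it consists of four points over a 4-set Q, then the sum of the heights
      determines the rank, hence the index
      ([block_extension_without_index]).

    This argument works for Steiner systems S(t, t + 1, v) in general
    ([uniform_family_gdd]).  It remains to find the family of SQS(10).  For
    g = 1 it would consist of seven disjoint systems, which do not exist.  But
    there are families for g = 2 and g = 3, given explicitly below
    ([double_coverP], [triple_coverP]).  Concatenating families adds the values
    of g, and every g >= 2 is a sum of twos and threes ([sqs10_family]). *)

(** * Steiner systems and uniform families *)

(** The Steiner systems S(t, t + 1, #|V|).  As the blocks have only one more
    point than the t-sets, it is the added point that is required to be unique,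
    rather than the block: this is the form in which blocks of the design are
    built, and it can be tested by running through the points. *)
Definition steiner (t : nat) (V : finType) (s : {set {set V}}) : Prop :=
  (forall Q, Q \in s -> #|Q| = t.+1) /\
  (forall T : {set V}, #|T| = t ->
     exists! v, v \notin T /\ v |: T \in s).

Record uniform_family (t g n : nat) (V : finType) (S : seq {set {set V}}) : Prop :=
 UniformFamily {
  family_size : size S = n;
  family_steiner : forall s, s \in S -> steiner t s;
  family_cover : forall Q : {set V}, #|Q| = t.+1 ->
    count (fun s : {set {set V}} => Q \in s) S = g
}.

Lemma uniform_family_cat t g h m n (V : finType) (S R : seq {set {set V}}) :
  uniform_family t g m S -> uniform_family t h n R ->
  uniform_family t (g + h) (m + n) (S ++ R).
Proof.
case=> sS stS cS [sR stR cR]; split=> [|s|Q cQ].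
- by rewrite size_cat sS sR.
- by rewrite mem_cat => /orP[/stS|/stR].
- by rewrite count_cat cS ?cR.
Qed.

(** * Testing a family by computation *)

(** Finite sets do not compute, so a subset of 'I_n is represented by the
    increasing list of its elements, and a system of blocks by a list of such
    lists; quantification over the m-subsets becomes quantification over
    [combs m (iota 0 n)]. *)
Fixpoint combs (T : Type) (m : nat) (s : seq T) : seq (seq T) :=
  match m, s with
  | 0, _ => [:: [::]]
  | _.+1, [::] => [::]
  | m'.+1, x :: s' => [seq x :: c | c <- combs m' s'] ++ combs m s'
  end.

Lemma mem_combs (T : eqType) (c s : seq T) : subseq c s -> c \in combs (size c) s.
Proof.
elim: s c => [|x s IHs] [|y c] //= sub_c.
rewrite mem_cat; move: sub_c; case: eqP => [->|_] sub_c.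
  by apply/orP; left; apply: map_f; apply: IHs.
by rewrite (IHs (y :: c)) ?orbT.
Qed.

Definition code n (Q : {set 'I_n}) : seq nat := [seq val x | x <- enum Q].

Definition decode n (L : seq (seq nat)) : {set {set 'I_n}} :=
  [set Q | code Q \in L].

Lemma size_code n (Q : {set 'I_n}) : size (code Q) = #|Q|.
Proof. by rewrite size_map cardE. Qed.

Lemma code_combs n (Q : {set 'I_n}) : code Q \in combs #|Q| (iota 0 n).
Proof.
rewrite -size_code; apply: mem_combs.
rewrite -(val_enum_ord n); apply: map_subseq.
by rewrite enumT; apply: filter_subseq.
Qed.

Lemma mem_code n (Q : {set 'I_n}) x : (val x \in code Q) = (x \in Q).
Proof. by rewrite mem_map ?mem_enum //; apply: val_inj. Qed.

Lemma code_sorted n (Q : {set 'I_n}) : sorted leq (code Q).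
Proof.
apply: (subseq_sorted leq_trans) (iota_sorted 0 n).
rewrite -(val_enum_ord n); apply: map_subseq.
by rewrite enumT; apply: filter_subseq.
Qed.

(** Adding a point to a set thus becomes an operation on lists, so that the
    extension property of a Steiner system can be evaluated. *)
Lemma code_setU1 n (Q : {set 'I_n}) x :
  x \notin Q -> code (x |: Q) = sort leq (val x :: code Q).
Proof.
move=> xQ; apply: (sorted_eq leq_trans anti_leq); rewrite ?code_sorted //.
  exact: sort_sorted leq_total _.
rewrite perm_sym perm_sort -[val x :: _]/[seq val y | y <- x :: enum Q] perm_map //.
apply: uniq_perm; rewrite /= ?enum_uniq ?mem_enum ?xQ // => y.
by rewrite inE !mem_enum !inE.
Qed.

Definition steiner_code n t (L : seq (seq nat)) : bool :=
  all (fun b => size b == t.+1) L &&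
  all (fun c => count (fun x => (x \notin c) && (sort leq (x :: c) \in L))
                      (iota 0 n) == 1)
      (combs t (iota 0 n)).

Lemma decode_steiner n t L : steiner_code n t L -> steiner t (decode n L).
Proof.
case/andP=> /allP sizeL /allP extL; split=> [Q|T cT].
  by rewrite inE -size_code => /sizeL/eqP.
have /extL : code T \in combs t (iota 0 n) by rewrite -cT code_combs.
rewrite -(val_enum_ord n) count_map -size_filter.
set s := filter _ _ => size_s.
have ext v : v \notin T /\ v |: T \in decode n L <-> v \in s.
  rewrite mem_filter mem_enum andbT /= mem_code inE.
  split; first by case=> vT; rewrite code_setU1 ?vT.
  by case/andP=> vT; rewrite code_setU1.
case: s size_s ext => [|v [|]] // _ ext; exists v; split=> [|w].
  by apply/ext; rewrite inE.
by move/ext; rewrite inE => /eqP.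
Qed.

Definition uniform_code n t g m (Ls : seq (seq (seq nat))) : bool :=
  [&& size Ls == m, all (steiner_code n t) Ls
    & all (fun c => count (fun L : seq (seq nat) => c \in L) Ls == g)
          (combs t.+1 (iota 0 n))].

Lemma decode_uniform n t g m Ls : uniform_code n t g m Ls ->
  uniform_family t g m [seq decode n L | L <- Ls].
Proof.
case/and3P=> /eqP sizeLs /allP steinerLs /allP coverLs; split=> [|s|Q cQ].
- by rewrite size_map.
- by case/mapP=> L /steinerLs/decode_steiner stL ->.
- rewrite count_map -(eqP (coverLs (code Q) _)); last by rewrite -cQ code_combs.
  by apply: eq_count => L /=; rewrite inE.
Qed.

(** * The families of SQS(10) for g = 2 and g = 3 *)

(** The cyclic SQS(10): three base quadruples, translated modulo 10. *)
Definition cyclic_blocks : seq (seq nat) :=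
  [seq [seq (x + i) %% 10 | x <- b]
     | b <- [:: [:: 0; 1; 2; 6]; [:: 0; 1; 3; 4]; [:: 0; 2; 4; 7]],
       i <- iota 0 10].

(** The image of the cyclic system under the permutation x |-> p_x. *)
Definition relabel (p : seq nat) : seq (seq nat) :=
  [seq sort leq [seq nth 0 p x | x <- b] | b <- cyclic_blocks].

(** The five images of a relabelled system under the powers of x |-> x + 2.
    Both families below are invariant under this map, so that one relabelling
    for each orbit describes them. *)
Definition rotations (p : seq nat) : seq (seq (seq nat)) :=
  [seq relabel [seq (x + k.*2) %% 10 | x <- p] | k <- iota 0 5].

(** Eleven systems that the two families share.  The cyclic system is its own
    orbit under x |-> x + 2. *)
Definition common_systems :=
  relabel (iota 0 10) ::
  rotations [:: 0; 1; 2; 3; 5; 9; 4; 6; 7; 8] ++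
  rotations [:: 0; 1; 2; 9; 6; 5; 8; 7; 3; 4].

(** The three added systems are each invariant under x |-> x + 2.  The first
    one is the cyclic system again, which thus occurs twice in the family. *)
Definition double_cover :=
  common_systems ++ [seq relabel p | p <-
    [:: iota 0 10; [:: 0; 1; 2; 4; 6; 9; 8; 7; 5; 3];
        [:: 1; 0; 6; 5; 8; 7; 3; 2; 4; 9]]].

Definition triple_cover :=
  common_systems ++
  rotations [:: 0; 1; 2; 4; 3; 5; 6; 7; 9; 8] ++
  rotations [:: 0; 1; 3; 2; 4; 6; 7; 9; 8; 5].

Lemma double_coverP : uniform_code 10 3 2 14 double_cover.
Proof. by vm_compute. Qed.

Lemma triple_coverP : uniform_code 10 3 3 21 triple_cover.
Proof. by vm_compute. Qed.

Lemma sqs10_family g : 2 <= g ->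
  exists S : seq {set {set 'I_10}}, uniform_family 3 g (7 * g) S.
Proof.
elim/ltn_ind: g => -[|[|[|[|g]]]] // IHg _.
- by eexists; apply: decode_uniform double_coverP.
- by eexists; apply: decode_uniform triple_coverP.
- have [//|//|S famS] := IHg g.+2; exists (S ++ map (decode 10) double_cover).
  rewrite -(addn2 g.+2) mulnDr.
  exact: uniform_family_cat famS (decode_uniform double_coverP).
Qed.

(** * Choosing an index by rank and a height by residue *)

(** The positions in a list at which a predicate holds are numbered by how many
    earlier positions satisfy it; this numbering is a bijection onto the
    numbers below the total count. *)
Lemma nth_count_take (T : Type) (x0 : T) (a : pred T) (s : seq T) r :
  r < count a s ->
  exists! j : 'I_(size s), a (nth x0 s j) /\ count a (take j s) = r.
Proof.
elim: s r => [|x s IHs] r //=; case ax: (a x) => /= lt_r; last first.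
  have [j [[aj cj] uj]] := IHs _ lt_r.
  exists (lift ord0 j); split=> [|i]; first by rewrite /= ax.
  case: (unliftP ord0 i) => [k|] ->; rewrite /= ?ax; last by case.
  by case=> ak ck; rewrite (uj k).
case: r lt_r => [|r] lt_r.
  exists ord0; split=> [|i]; first by rewrite /= ax.
  by case: (unliftP ord0 i) => [k|] -> //=; rewrite ax; case.
have [j [[aj cj] uj]] := IHs _ lt_r.
exists (lift ord0 j); split=> [|i]; first by rewrite /= ax cj.
case: (unliftP ord0 i) => [k|] ->; rewrite /= ?ax; last by case.
by case=> ak [ck]; rewrite (uj k).
Qed.

Lemma exists_unique_addn_mod g m r : r < g ->
  exists! i : 'I_g, (i + m) %% g = r.
Proof.
move=> lt_r; have g_gt0 := leq_ltn_trans (leq0n r) lt_r.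
have le_mg : m %% g <= g by rewrite ltnW ?ltn_pmod.
exists (Ordinal (ltn_pmod (r + (g - m %% g)) g_gt0)); split=> [|i im] /=.
  rewrite modnDml -modnDmr -addnA subnK //.
  by rewrite modnDr modn_small.
apply: val_inj => /=; rewrite -im modnDml -addnA -modnDmr -modnDml.
rewrite -(modnDml m) subnKC // modnn addn0.
by rewrite modn_mod modn_small.
Qed.

(** When all blocks are one point larger than T, a block through T amounts to
    one added point. *)
Lemma exists_unique_superset (X : finType) (B : {set {set X}}) (T : {set X}) :
  (forall b, b \in B -> #|b| = #|T|.+1) ->
  (exists! y, y \notin T /\ y |: T \in B) ->
  exists! b : {set X}, b \in B /\ T \subset b.
Proof.
move=> sizeB [y [[yT By] uy]]; exists (y |: T).
split=> [|b [Bb sTb]]; first by rewrite subsetUr.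
have /cards1P[z bT] : #|b :\: T| == 1.
  by rewrite cardsD (setIidPr sTb) sizeB // subSnn.
have def_b : b = z |: T by rewrite -bT setUC -{1}(setID b T) (setIidPr sTb).
have zT : z \notin T by have:= set11 z; rewrite -bT inE => /andP[].
by rewrite (uy z) -?def_b.
Qed.

(** * The group divisible design of a uniform family *)

Section Construction.

Variables (V : finType) (g t : nat) (S : seq {set {set V}}).
Hypotheses (g_gt0 : 0 < g) (S_gt0 : 0 < size S).
Hypothesis family : uniform_family t g (size S) S.

(** The indices of the systems form the long group. *)
Definition point : finType := ((V * 'I_g) + 'I_(size S))%type.

(** Groups are labelled by [option V], with [None] for the long group.  Being
    transverse then means that [group_of] is injective. *)
Definition group_of (x : point) : option V :=
  match x with inl (v, _) => Some v | inr _ => None end.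

(** Indices get height 0, so that the heights of a whole block can be summed
    without singling out its index. *)
Definition height (x : point) : nat :=
  match x with inl (_, i) => nat_of_ord i | inr _ => 0 end.

Definition fibre (o : option V) : {set point} := [set x | group_of x == o].

Definition groups : {set {set point}} := [set fibre o | o : option V].

(** The projection of a set of points to V. *)
Definition shadow (b : {set point}) : {set V} :=
  [set v | Some v \in [set group_of x | x in b]].

Definition system (j : 'I_(size S)) : {set {set V}} := nth set0 S j.

(** The number of systems containing Q that come before the j-th one. *)
Definition rank (Q : {set V}) (j : 'I_(size S)) : nat :=
  count (fun s : {set {set V}} => Q \in s) (take j S).

Definition blocks : {set {set point}} :=
  [set b : {set point} | (#|[set group_of x | x in b]| == #|b|) &&
    [exists j, [&& inr j \in b, shadow b \in system j
                 & (\sum_(x in b) height x) %% g == rank (shadow b) j]]].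

Lemma card_point : #|point| = #|V| * g + size S.
Proof. by rewrite card_sum card_prod !card_ord. Qed.

Lemma card_fibre o :
  #|fibre o| = if o is Some _ then g else size S.
Proof.
case: o => [v|].
  have ->: fibre (Some v) = [set inl (v, i) | i : 'I_g].
    apply/setP=> -[[w i]|j]; rewrite inE /=.
      apply/eqP/imsetP=> [[->]|[k _ [-> _]] //]; by exists i.
    by apply/esym/negP=> /imsetP[].
  by rewrite card_imset ?card_ord // => i k [].
have ->: fibre None = [set inr j | j : 'I_(size S)].
  apply/setP=> -[[w i]|j]; rewrite inE /=; last by rewrite imset_f.
  by apply/esym/negP=> /imsetP[].
by rewrite card_imset ?card_ord // => i k [].
Qed.

Lemma fibre_inj : injective fibre.
Proof.
move=> o1 o2 eq_o; have: 0 < #|fibre o1| by rewrite card_fibre; case: (o1).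
case/card_gt0P=> x x1; have x2 := x1; rewrite eq_o in x2.
by move: x1 x2; rewrite !inE => /eqP <- /eqP.
Qed.

Lemma groups_partition : partition groups [set: point].
Proof.
have ->: groups = preim_partition group_of [set: point].
  apply/setP=> A; apply/imsetP/imsetP=> [[o _ ->]|[x _ ->]].
    have: 0 < #|fibre o| by rewrite card_fibre; case: (o).
    case/card_gt0P=> x; rewrite inE => /eqP <-; exists x => //.
    by apply/setP=> y; rewrite !inE eq_sym.
  by exists (group_of x) => //; apply/setP=> y; rewrite !inE eq_sym.
exact: preim_partitionP.
Qed.

Lemma groups_type :
  perm_eq [seq #|A| | A : {set point} in groups]
          (tally_seq [:: (g, #|V|); (size S, 1)]).
Proof.
have enumG : perm_eq (enum groups) [seq fibre o | o : option V].
  apply: uniq_perm; rewrite ?enum_uniq //.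
    by rewrite map_inj_uniq ?enum_uniq //; apply: fibre_inj.
  move=> A; rewrite mem_enum; apply/imsetP/imageP.
    by case=> o _ ->; exists o.
  by case=> o _ ->; exists o.
have enumO : perm_eq (enum {: option V}) (rcons (map Some (enum V)) None).
  apply: uniq_perm; rewrite ?enum_uniq ?rcons_uniq //.
    rewrite map_inj_uniq ?enum_uniq ?andbT; last by move=> u v [].
    by apply/mapP=> -[].
  case=> [v|]; rewrite mem_enum mem_rcons inE // map_f //.
  by rewrite mem_enum.
rewrite /image_mem (perm_trans (perm_map _ enumG)) //.
rewrite -map_comp (perm_trans (perm_map _ enumO)) // map_rcons /=.
rewrite card_fibre -map_comp (@eq_map _ _ _ (fun=> g)); last first.
  by move=> v /=; rewrite card_fibre.
have map_cst (s : seq V) : [seq g | _ <- s] = nseq (size s) g.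
  by elim: s => //= _ s ->.
by rewrite map_cst -cats1 cardE.
Qed.

Lemma transverseP (b : {set point}) :
  transverse groups b <-> {in b &, injective group_of}.
Proof.
split=> [trb x y xb yb eq_xy|injb A /imsetP[o _ ->]].
  have: fibre (group_of x) \in groups by apply: imset_f.
  move/trb/card_le1_eqP; apply; rewrite !inE ?xb ?yb ?eq_xy //=.
apply/card_le1_eqP=> x y; rewrite !inE.
by case/andP=> xb /eqP ox /andP[yb /eqP oy]; apply: injb; rewrite ?ox.
Qed.

Lemma mem_shadow b v : (v \in shadow b) = [exists i, inl (v, i) \in b].
Proof.
rewrite inE; apply/imsetP/existsP=> [[[[w i]|j] xb //= [->]]|[i ib]].
  by exists i.
by exists (inl (v, i)).
Qed.

Lemma shadowU1l v i (b : {set point}) : shadow (inl (v, i) |: b) = v |: shadow b.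
Proof. by apply/setP=> w; rewrite inE imsetU1 !in_setU1 [in RHS]inE. Qed.

Lemma shadowU1r j (b : {set point}) : shadow (inr j |: b) = shadow b.
Proof. by apply/setP=> w; rewrite inE imsetU1 !in_setU1 [in RHS]inE. Qed.

(** By injectivity a transverse set has at most one index, and it projects
    bijectively onto its shadow apart from that index. *)
Lemma card_shadow (b : {set point}) : {in b &, injective group_of} ->
  #|b| = [exists j, inr j \in b] + #|shadow b|.
Proof.
move=> injb; rewrite -(card_in_imset injb).
rewrite (cardsD1 None); congr (nat_of_bool _ + _).
  apply/imsetP/existsP=> [[[[w i]|j] xb //= _]|[j jb]]; first by exists j.
  by exists (inr j).
rewrite -(card_imset (mem (shadow b)) (@Some_inj _)).
apply: eq_card => -[v|]; rewrite !inE /=.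
  by rewrite mem_imset ?inE //; apply: Some_inj.
by apply/esym/negP=> /imsetP[].
Qed.

Lemma blocksP (b : {set point}) :
  reflect ({in b &, injective group_of} /\
    exists j, [/\ inr j \in b, shadow b \in system j
                & (\sum_(x in b) height x) %% g = rank (shadow b) j])
    (b \in blocks).
Proof.
rewrite inE; apply: (iffP andP) => [[/imset_injP injb]|[/imset_injP injb]] exj;
  split=> //.
  by case/existsP: exj => j /and3P[? ? /eqP ?]; exists j.
case: exj => j [? ? ?]; apply/existsP; exists j.
by apply/and3P; split=> //; apply/eqP.
Qed.

Lemma system_steiner j : steiner t (system j).
Proof. exact: (family_steiner family) (mem_nth _ _). Qed.

Lemma card_block b : b \in blocks -> #|b| = t.+2.
Proof.
case/blocksP=> injb [j [jb Qj _]]; rewrite card_shadow //.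
have ->: [exists j, inr j \in b] by apply/existsP; exists j.
by rewrite (proj1 (system_steiner j)).
Qed.

Lemma rank_lt (Q : {set V}) j : #|Q| = t.+1 -> Q \in system j -> rank Q j < g.
Proof.
move=> cQ Qj; rewrite -(family_cover family cQ) /rank.
rewrite -[in X in _ < X](cat_take_drop j S) count_cat.
rewrite (drop_nth set0) //= -/(system j) Qj -addn1 leq_add2l.
exact: leq_addr.
Qed.

(** The g systems through Q have ranks 0, ..., g - 1: this is where each
    (t+1)-set has to be covered exactly g times. *)
Lemma exists_unique_system (Q : {set V}) r : #|Q| = t.+1 -> r < g ->
  exists! j, Q \in system j /\ rank Q j = r.
Proof. by move=> /(family_cover family) {1}<-; apply: nth_count_take. Qed.

Lemma injU1 x (T : {set point}) : x \notin T ->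
  {in x |: T &, injective group_of} <->
  {in T &, injective group_of} /\ group_of x \notin [set group_of y | y in T].
Proof.
move=> xT; split=> [injxT|[injT gx] y z].
  split=> [y z yT zT|]; first by apply: injxT; rewrite setU1r.
  apply/imsetP=> -[y yT] /injxT eq_xy.
  by rewrite eq_xy ?setU11 ?setU1r ?yT // in xT.
case/setU1P=> [->|yT] /setU1P[->|zT] // eq_yz; last exact: injT.
- by rewrite eq_yz imset_f in gx.
- by rewrite -eq_yz imset_f in gx.
Qed.

(** The shadow has t points, so the system of index j forces the group of the
    added point, and the congruence forces its height. *)
Lemma block_extension_with_index (T : {set point}) j : #|T| = t.+1 ->
  {in T &, injective group_of} -> inr j \in T ->
  exists! y, y \notin T /\ y |: T \in blocks.
Proof.
move=> cT injT jT.
have cQ : #|shadow T| = t.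
  have := card_shadow injT.
  have ->: [exists j, inr j \in T] by apply/existsP; exists j.
  by rewrite cT => -[].
have [v [[vT Qj] uv]] := proj2 (system_steiner j) _ cQ.
set Q := v |: shadow T in Qj.
have cvQ : #|Q| = t.+1 by rewrite cardsU1 vT cQ.
have [i [im ui]] :=
  exists_unique_addn_mod (\sum_(x in T) height x) (rank_lt cvQ Qj).
have notinT w k : w \notin shadow T -> inl (w, k) \notin T.
  by apply: contraNN => wT; rewrite mem_shadow; apply/existsP; exists k.
exists (inl (v, i)); split=> [|y [yT By]].
  split; first exact: notinT.
  have gv : Some v \notin [set group_of y | y in T] by have:= vT; rewrite inE.
  apply/blocksP; split; first by apply/injU1; first exact: notinT.
  exists j; rewrite setU1r // shadowU1l; split=> //.
  by rewrite big_setU1 ?notinT.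
have [/(injU1 yT)[_ gy] [k [kT]]] := blocksP _ By.
(* The block is transverse, so it has only one point in the long group. *)
have eq_k : k = j.
  have := proj1 (blocksP _ By) (inr k) (inr j) kT (setU1r _ jT) erefl.
  by case.
rewrite {k}eq_k in kT *.
case: y yT By gy kT => [[w k]|k] yT By gy kT; last first.
  by case/imsetP: gy; exists (inr j).
rewrite shadowU1l big_setU1 // => Qw hw.
have eq_vw : v = w by apply: uv; rewrite inE.
by rewrite -eq_vw in hw *; rewrite (ui k).
Qed.

(** The shadow has t + 1 points, so it is the shadow of the block and the added
    point is an index: the one whose rank is the residue of the sum of the
    heights. *)
Lemma block_extension_without_index (T : {set point}) : #|T| = t.+1 ->
  {in T &, injective group_of} -> (forall j, inr j \notin T) ->
  exists! y, y \notin T /\ y |: T \in blocks.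
Proof.
move=> cT injT noindexT.
have cQ : #|shadow T| = t.+1.
  have := card_shadow injT; have ->: [exists j, inr j \in T] = false.
    by apply/existsP=> -[j]; rewrite (negPf (noindexT j)).
  by rewrite cT.
have lt_r := ltn_pmod (\sum_(x in T) height x) g_gt0.
have [j [[Qj rj] uj]] := exists_unique_system cQ lt_r.
exists (inr j); split=> [|y [yT By]].
  split=> //; apply/blocksP; split.
    apply/injU1=> //; split=> //; apply/imsetP=> -[[[w k]|k] //=].
    by rewrite (negPf (noindexT k)).
  by exists j; rewrite setU11 shadowU1r big_setU1.
have [_ [k [kT]]] := blocksP _ By.
have def_y : y = inr k.
  by case/setU1P: kT => // kT; rewrite (negPf (noindexT k)) in kT.
rewrite {y}def_y in yT By kT *; rewrite shadowU1r big_setU1 //= => Qk hk.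
by rewrite (uj k).
Qed.

Theorem uniform_family_gdd : 0 < t ->
  is_gdd t.+1 t.+2 (#|V| * g + size S) [:: (g, #|V|); (size S, 1)] groups blocks.
Proof.
move=> t_gt0; split=> //.
- by rewrite !big_cons big_nil /= mul1n addn0.
- exact: card_point.
- exact: groups_partition.
- exact: groups_type.
- exact: card_block.
- by move=> b /blocksP[injb _]; apply/transverseP.
move=> T cT /transverseP injT; apply: exists_unique_superset.
  by move=> b /card_block->; rewrite cT.
case: (boolP [exists j, inr j \in T]) => [/existsP[j jT]|/existsPn noindexT].
  exact: block_extension_with_index jT.
exact: block_extension_without_index.
Qed.

End Construction.

Theorem corollary4 :
  forall g : nat, 2 <= g ->
  exists (X : finType) (G B : {set {set X}}),
    is_gdd 4 5 (10 * g + 7 * g) [:: (g, 10); (7 * g, 1)] G B.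
Proof.
move=> g g_ge2; have g_gt0 := ltnW g_ge2.
have [S famS] := sqs10_family g_ge2; have sizeS := family_size famS.
rewrite -sizeS in famS *.
exists (point g S), (groups g S), (blocks g S).
have S_gt0 : 0 < size S by rewrite sizeS muln_gt0.
by have := uniform_family_gdd g_gt0 S_gt0 famS isT; rewrite card_ord.
Qed.
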